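(* Let $L=[l_{ij}]\in\mathbb{R}^{n\times n}$ be such that $-L\in\mathbf{A}_2$ (equivalently, $L$ is the graph Laplacian of a strongly connected weighted directed graph), and let $\xi=[\xi_1,\dots,\xi_n]^\top$ be the left eigenvector of $L$ for the eigenvalue $0$ with $\sum_{i=1}^n\xi_i=1$. Let $s\in\mathbb{R}$, let $0<\eta_1\le\eta_2<1/\xi_1$, and let $(b_k)$ be a sequence with $b_k\in[\eta_1,\eta_2]$ for each $k$. Let $x(0)\in\mathbb{R}^n$ satisfy $\bar x(0)=\sum_{i=1}^n\xi_ix_i(0)\neq s$. Then there is a constant $T>0$ such that for every sequence $0=t_0<t_1<t_2<\cdots$ with $\Delta t_k=t_{k+1}-t_k\ge T$ for each $k\ge 0$, the solution $x(t)$, with initial value $x(0)$, of the impulsively pinned system with strengths $b_k$, impulse times $t_k$ and target value $s$ reaches consensus on $s$, i.e. $\lim_{t\to\infty}x_i(t)=s$ for all $i=1,\dots,n$.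
   Context: Class $\mathbf{A}_2$: a matrix $A=[a_{ij}]\in\mathbb{R}^{n\times n}$ belongs to $\mathbf{A}_2$ if $a_{ij}\ge 0$ for $i\ne j$, $a_{ii}=-\sum_{j\ne i}a_{ij}$ for all $i$, and $A$ is irreducible. If $-L\in\mathbf{A}_2$, then $0$ is a simple eigenvalue of $L$ and the normalized left eigenvector $\xi$ has all entries positive. Impulsively pinned system (pinning node $1$, target $s$): $x(t)=[x_1(t),\dots,x_n(t)]^\top$ satisfies $$\dot x_i(t)=-\sum_{j=1}^n l_{ij}x_j(t),\quad i=1,\dots,n,\ t\ne t_k,$$ $$x_1(t_k^+)=x_1(t_k^-)+b_k\,[s-x_1(t_k^-)],\qquad x_i(t_k^+)=x_i(t_k^-)\ \ (i=2,\dots,n),$$ where $b_k$ is the impulsive strength at time $t_k$ and $x(t_k^\pm)$ are one-sided limits. Convention: $x(t_k)=x(t_k^+)$; the initial value is $x(0)=x(t_0^+)$, so the impulses acting on the solution are those at $t_k$, $k\ge1$. *)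

(* Defs.v *)
From HB Require Import structures.
From mathcomp Require Import all_boot all_order all_algebra all_fingroup.
From mathcomp Require Import all_classical all_reals all_analysis.
Set Implicit Arguments.
Unset Strict Implicit.
Unset Printing Implicit Defensive.
Import Order.TTheory GRing.Theory Num.Theory.
Import numFieldNormedType.Exports.
Local Open Scope classical_set_scope.
Local Open Scope ring_scope.

(* Some simultaneous permutation of rows and columns brings A to the form
   [B C; 0 D] with square diagonal blocks B (r rows) and D (n - r rows),
   both nonempty.  In particular no matrix of size at most 1 is reducible. *)
Definition reducible_mx (R : realType) (n : nat) (A : 'M[R]_n) : Prop :=
  exists (p : 'S_n) (r : nat), [/\ (0 < r)%N, (r < n)%N &
    forall i j : 'I_n, (r <= i)%N -> (j < r)%N ->
      row_perm p (col_perm p A) i j = 0].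

Definition irreducible_mx (R : realType) (n : nat) (A : 'M[R]_n) : Prop :=
  ~ reducible_mx A.

Definition classA2 (R : realType) (n : nat) (A : 'M[R]_n) : Prop :=
  [/\ forall i j, i != j -> 0 <= A i j,
      forall i, A i i = - \sum_(j | j != i) A i j &
      irreducible_mx A].

(* x is a solution on [0, +oo[ (its values at negative times are irrelevant).
   The pinned node is ord0.  The impulses act at t k for 0 < k only, so b 0 is
   not used; the one-sided limits x(t_k^-) are required to exist and are
   named xm, and x(t_k) = x(t_k^+) is imposed for every k, including k = 0. *)
Definition pinned_solution (R : realType) (n : nat) (L : 'M[R]_n.+1)
    (b t : nat -> R) (s : R) (x0 : 'cV[R]_n.+1) (x : R -> 'cV[R]_n.+1) : Prop :=
  [/\ x 0 = x0,
      forall (u : R) (i : 'I_n.+1), 0 < u -> (forall k, u != t k) ->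
        is_derive u 1 (fun v : R => x v i 0) (- \sum_j L i j * x u j 0),
      forall k (i : 'I_n.+1), x u i 0 @[u --> (t k)^'+] --> x (t k) i 0 &
      forall k, (0 < k)%N -> exists xm : 'cV[R]_n.+1,
        [/\ forall i, x u i 0 @[u --> (t k)^'-] --> xm i 0,
            x (t k) ord0 0 = xm ord0 0 + b k * (s - xm ord0 0) &
            forall i, i != ord0 -> x (t k) i 0 = xm i 0]].

(* Main.v *)
(* Between impulses the weighted mean [m = sum xi_i x_i] is constant and the
   variance [V = sum xi_i (x_i - m)^2] satisfies [V' = - E], where [E] is the
   Dirichlet form; strong connectivity gives [lam V <= E], so after a long
   enough gap every node is within [eps D] of [m], [D] being the largest
   deviation at the beginning of the gap.  The impulse then acts almost as
   [m - s |-> (1 - xi_1 b_k) (m - s)] and creates a deviation of order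
   [|m - s| + eps D].  Hence [|m - s| + kappa D] contracts by a fixed factor at
   each impulse when [kappa], and then [eps], are small. *)
Require Import Defs.
From HB Require Import structures.
From mathcomp Require Import all_boot all_order all_algebra all_fingroup.
From mathcomp Require Import all_classical all_reals all_analysis.
From mathcomp Require Import ring lra.
Import Order.TTheory GRing.Theory Num.Theory.
Import numFieldNormedType.Exports.
Local Open Scope classical_set_scope.
Local Open Scope ring_scope.
Set Implicit Arguments.
Unset Strict Implicit.
Unset Printing Implicit Defensive.

(** * Irreducibility and positivity of the left eigenvector *)

Lemma classA2_rowsum (R : realType) (n : nat) (A : 'M[R]_n) :
  classA2 A -> forall i, \sum_j A i j = 0.
Proof. by move=> [_ dA _] i; rewrite (bigD1 i)//= dA addNr. Qed.

(** If [j] is unreachable from [i], no edge leaves the set [S] of nodes reachable from [i]; listing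
    the nodes outside [S] first then exhibits a zero lower left block. *)
Lemma classA2_connect (R : realType) (n : nat) (A : 'M[R]_n) :
  classA2 A -> forall i j, connect (fun i j => 0 < A i j) i j.
Proof.
move=> [offA _ irrA] i j; apply/negP => /negP nij; apply: irrA.
pose S := connect (fun i j => 0 < A i j) i.
pose s := enum [predC S] ++ enum S.
have sz_s : size s = n by rewrite size_cat -!cardE addnC cardC card_ord.
have uniq_s : uniq s.
  rewrite cat_uniq !enum_uniq andbT; apply/hasPn => k.
  by rewrite !mem_enum !inE => ->.
pose f (k : 'I_n) := nth i s k.
have f_inj : injective f.
  by move=> k l /eqP; rewrite nth_uniq ?sz_s// => /eqP/val_inj.
exists (perm f_inj), #|[predC S]|; split.
- by apply/card_gt0P; exists j.
- rewrite -[X in (_ < X)%N](card_ord n) -(cardC S) -[X in (X < _)%N]add0n.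
  by rewrite ltn_add2r; apply/card_gt0P; exists i; exact: connect0.
move=> k l rk lr; rewrite !mxE !permE.
have Sk : f k \in S.
  rewrite -mem_enum /f nth_cat -cardE ltnNge rk/= mem_nth// -cardE.
  by rewrite ltn_subLR// addnC cardC card_ord.
have nSl : f l \notin S.
  have : f l \in enum [predC S] by rewrite /f nth_cat -cardE lr mem_nth// -cardE.
  by rewrite mem_enum inE.
have kl : f k != f l by apply: contraNneq nSl => <-.
apply/eqP; rewrite eq_le offA// andbT leNgt; apply: contra nSl => Akl.
exact: connect_trans Sk (connect1 Akl).
Qed.

(** Zeros spread backwards along edges: where [nu k = 0], column [k] of [nu A = 0] is a vanishing
    sum of nonnegative terms, so [nu i = 0] whenever [0 < A i k]. *)
Lemma left_null_eq0 (R : realType) (n : nat) (A : 'M[R]_n) (nu : 'I_n -> R) :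
  classA2 A -> (forall i, 0 <= nu i) -> (forall j, \sum_i nu i * A i j = 0) ->
  forall j, nu j = 0 -> forall i, nu i = 0.
Proof.
move=> A2 nu0 nuA j nuj i; have [offA _ _] := A2.
have /connectP[p] := classA2_connect A2 i j.
elim: p i => [|k p IH] i /=; first by move=> _ <-.
move=> /andP[Aik kp] jE; have nuk := IH k kp jE.
have term_ge0 l : true -> 0 <= nu l * A l k.
  have [->|lk] := eqVneq l k; first by rewrite nuk mul0r.
  by rewrite mulr_ge0// offA.
have /eqP := psumr_eq0P term_ge0 (nuA k) (i := i) isT.
by rewrite mulf_eq0 (gt_eqF Aik) orbF => /eqP.
Qed.

(* Taking absolute values in [xi A = 0] gives [|xi| A >= 0] entrywise, and the
   entries of [|xi| A] add up to 0 because the rows of [A] do. *)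
Lemma left_eigenvector_gt0 (R : realType) (n : nat) (A : 'M[R]_n)
    (xi : 'I_n -> R) :
  classA2 A -> (forall j, \sum_i xi i * A i j = 0) -> \sum_i xi i = 1 ->
  forall i, 0 < xi i.
Proof.
move=> A2 xiA xi1; have [offA dA _] := A2.
have absA_ge0 j : true -> 0 <= \sum_i `|xi i| * A i j.
  move=> _; have Ajj : A j j <= 0.
    by rewrite dA oppr_le0; apply: sumr_ge0 => i; rewrite eq_sym; exact: offA.
  have: `|xi j| * - A j j <= \sum_(i | i != j) `|xi i| * A i j.
    have /eqP := xiA j; rewrite (bigD1 j)//= addrC addr_eq0 => /eqP xijE.
    rewrite -(ger0_norm (_ : 0 <= - A j j)) ?oppr_ge0// -normrM mulrN -xijE.
    apply: le_trans (ler_norm_sum _ _ _) _; apply: ler_sum => i ij.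
    by rewrite normrM (ger0_norm (offA _ _ ij)).
  by rewrite [X in _ -> 0 <= X](bigD1 j)//= mulrN; lra.
have absA : forall j, \sum_i `|xi i| * A i j = 0.
  have tot0 : \sum_j \sum_i `|xi i| * A i j = 0.
    rewrite exchange_big/= big1// => i _.
    by rewrite -mulr_sumr classA2_rowsum ?mulr0.
  by move=> j; apply: (psumr_eq0P absA_ge0 tot0).
have [i0 xi0] : exists i, 0 < xi i.
  apply: contrapT => /forallNP xiN.
  suff : \sum_i xi i <= 0 by rewrite xi1 ler10.
  by apply: sumr_le0 => i _; rewrite leNgt; apply/negP/xiN.
have xi_ge0 i : 0 <= xi i.
  (* [|xi| - xi] is a nonnegative left null vector that vanishes at [i0], hence everywhere. *)
  have nu_eq0 : `|xi i| - xi i = 0.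
    apply: (left_null_eq0 (nu := fun k => `|xi k| - xi k) A2 _ _ (j := i0)).
    - by move=> k; rewrite subr_ge0 ler_norm.
    - move=> k; under eq_bigr => l _ do rewrite mulrBl.
      by rewrite sumrB absA xiA subrr.
    - by rewrite (gtr0_norm xi0) subrr.
  by have := normr_ge0 (xi i); lra.
move=> i; rewrite lt_def xi_ge0 andbT; apply/eqP => xii.
have := oner_neq0 R; rewrite -xi1 big1 ?eqxx// => k _.
exact: (left_null_eq0 A2 xi_ge0 xiA xii).
Qed.

(** * The Dirichlet form and its Poincare inequality *)

Definition dirichlet (R : realType) (n : nat) (xi : 'I_n -> R) (A : 'M[R]_n)
    (y : 'I_n -> R) : R :=
  \sum_i \sum_j xi i * A i j * (y i - y j) ^+ 2.

(** The left side is the derivative of [sum xi_i (y_i - c)^2] along [y' = A y]. When [(y_i - y_j)^2]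
    is expanded about [c], the pure squares sum to 0 by the zero row sums and by [xi A = 0], and the
    cross terms remain. *)
Lemma dirichlet_energy (R : realType) (n : nat) (A : 'M[R]_n) (xi : 'I_n -> R)
    (y : 'I_n -> R) (c : R) :
  (forall i, \sum_j A i j = 0) -> (forall j, \sum_i xi i * A i j = 0) ->
  2 * \sum_i xi i * (y i - c) * \sum_j A i j * y j = - dirichlet xi A y.
Proof.
move=> A1 xiA; rewrite /dirichlet.
have E0 : \sum_i \sum_j xi i * A i j * (y i - c) ^+ 2 = 0.
  apply: big1 => i _; rewrite -mulr_suml -mulr_sumr A1; ring.
have E1 : \sum_i \sum_j xi i * A i j * (y j - c) ^+ 2 = 0.
  rewrite exchange_big/=; apply: big1 => j _.
  by rewrite -mulr_suml xiA mul0r.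
have E2 : \sum_i \sum_j xi i * A i j * (y i - c) * c = 0.
  by apply: big1 => i _; rewrite -!mulr_suml -mulr_sumr A1; ring.
have -> : \sum_i \sum_j xi i * A i j * (y i - y j) ^+ 2 =
  \sum_i \sum_j xi i * A i j * (y i - c) ^+ 2 +
  \sum_i \sum_j xi i * A i j * (y j - c) ^+ 2 +
  2 * \sum_i \sum_j xi i * A i j * (y i - c) * c
  - 2 * \sum_i xi i * (y i - c) * \sum_j A i j * y j.
  rewrite !mulr_sumr -!big_split/= -sumrB; apply: eq_bigr => i _.
  rewrite !mulr_sumr -!big_split/= -sumrB; apply: eq_bigr => j _; ring.
rewrite E0 E1 E2; ring.
Qed.

(** The difference across an edge is controlled by a single term of the form; following a path from
    [i] to [ord0] then bounds [(y i - y ord0)^2] by a multiple of the form. *)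
Lemma dirichlet_poincare (R : realType) (n : nat) (A : 'M[R]_n.+1)
    (xi : 'I_n.+1 -> R) :
  classA2 A -> (forall i, 0 < xi i) -> \sum_i xi i = 1 ->
  exists2 lam : R, 0 < lam & forall y : 'I_n.+1 -> R,
    lam * \sum_i xi i * (y i - \sum_j xi j * y j) ^+ 2 <= dirichlet xi A y.
Proof.
move=> A2 xi0 xi1; have [offA _ _] := A2.
have term_ge0 y i j : 0 <= xi i * A i j * (y i - y j) ^+ 2.
  have [->|ij] := eqVneq i j; first by rewrite subrr expr0n mulr0.
  by rewrite mulr_ge0 ?sqr_ge0// mulr_ge0 ?offA// ltW.
have D_ge0 y : 0 <= dirichlet xi A y.
  by apply: sumr_ge0 => i _; exact: sumr_ge0.
have edge i j y : xi i * A i j * (y i - y j) ^+ 2 <= dirichlet xi A y.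
  rewrite /dirichlet (bigD1 i)//= (bigD1 j)//= -addrA lerDl.
  by rewrite addr_ge0 ?sumr_ge0// => k _; exact: sumr_ge0.
have pair i j : exists C : R, 0 <= C /\ forall y : 'I_n.+1 -> R,
    (y i - y j) ^+ 2 <= C * dirichlet xi A y.
  have /connectP[p] := classA2_connect A2 i j.
  elim: p i => [|k p IH] i /=.
    by move=> _ ->; exists 0; split => // y; rewrite subrr expr0n mul0r.
  move=> /andP[Aik kp] jE; have [C [C0 CP]] := IH k kp jE.
  have w0 : 0 < xi i * A i k by rewrite mulr_gt0.
  exists (2 * C + 2 / (xi i * A i k)); split.
    by rewrite addr_ge0 ?mulr_ge0// invr_ge0 ltW.
  move=> y; have := CP y; have := edge i k y.
  rewrite mulrC -ler_pdivlMr// => ik kj.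
  have -> : (2 * C + 2 / (xi i * A i k)) * dirichlet xi A y =
    2 * (C * dirichlet xi A y) + 2 * (dirichlet xi A y / (xi i * A i k)) by ring.
  (* The inequality [(a + b)^2 <= 2 a^2 + 2 b^2] splits off the first edge of the path. *)
  have := sqr_ge0 ((y i - y k) - (y k - y j)).
  have -> : (y i - y j) ^+ 2 = 2 * (y i - y k) ^+ 2 + 2 * (y k - y j) ^+ 2 -
    ((y i - y k) - (y k - y j)) ^+ 2 by ring.
  lra.
have [C CP] := choice (fun i => pair i ord0).
have S0 : 0 <= \sum_i xi i * C i.
  by apply: sumr_ge0 => i _; rewrite mulr_ge0 ?(ltW (xi0 i))//; case: (CP i).
(* The summand 1 makes the inverse positive even if all [C i] vanish. *)
exists (1 + \sum_i xi i * C i)^-1; first by rewrite invr_gt0 ltr_pwDl.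
move=> y; rewrite mulrC ler_pdivrMr ?ltr_pwDl//.
(* The weighted mean minimizes the weighted sum of squared deviations. *)
apply: (@le_trans _ _ (\sum_i xi i * (y i - y ord0) ^+ 2)).
  set m := \sum_j xi j * y j.
  have -> : \sum_i xi i * (y i - y ord0) ^+ 2 =
      \sum_i xi i * (y i - m) ^+ 2 + (m - y ord0) ^+ 2.
    transitivity (\sum_i (xi i * (y i - m) ^+ 2 +
        (2 * (m - y ord0) * (xi i * y i) - 2 * (m - y ord0) * m * xi i +
         (m - y ord0) ^+ 2 * xi i))).
      by apply: eq_bigr => i _; ring.
    rewrite big_split/= big_split/= sumrB -!mulr_sumr xi1 -/m; ring.
  by rewrite lerDl sqr_ge0.
rewrite mulrDr mulr1 mulr_sumr.
rewrite [leRHS]addrC -[leLHS]addr0; apply: lerD => //.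
apply: ler_sum => i _; rewrite [leRHS]mulrCA ler_pM2l// mulrC.
by case: (CP i).
Qed.

(** * Decay towards the weighted mean along the linear flow *)

Lemma le_at_right_limit (R : realType) (f df : R -> R) (a b l : R) :
  (forall u, a < u < b -> is_derive u 1 f (df u)) ->
  (forall u, a < u < b -> df u <= 0) ->
  f v @[v --> a^'+] --> l -> forall u, a < u < b -> f u <= l.
Proof.
move=> fdf df0 fl u /andP[au ub].
have in_ab v : v \in `]a, b[ -> a < v < b by rewrite in_itv.
have dfab v : v \in `]a, b[ -> derivable f v 1.
  by move=> /in_ab/fdf [].
apply: cvgr_to_ge fl _; near=> v.
have av : a < v by near: v; exact: nbhs_right_gt.
have vu : v < u by near: v; exact: nbhs_right_lt.
apply: (@ler0_derive1_le_oo R f a b) => //.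
- move=> w /in_ab wab; rewrite derive1E.
  by have := fdf w wab => -[_ ->]; exact: df0.
- move=> w; rewrite inE => /dfab dfw.
  exact/differentiable_continuous/derivable1_diffP.
- by rewrite in_itv/= au ub.
- by rewrite in_itv/= av (lt_trans vu ub).
- exact: ltW.
Unshelve. all: by end_near. Qed.

(** The interval is open and the initial value is a right limit, so that this fits a solution that
    jumps at both endpoints. *)
Definition linear_flow (R : realType) (n : nat) (A : 'M[R]_n) (a b : R)
    (f0 : 'I_n -> R) (f : 'I_n -> R -> R) : Prop :=
  (forall u, a < u < b ->
     forall i, is_derive u 1 (f i) (\sum_j A i j * f j u)) /\
  forall i, f i v @[v --> a^'+] --> f0 i.

Lemma linear_flow_mean (R : realType) (n : nat) (A : 'M[R]_n) (xi : 'I_n -> R)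
    (a b : R) (f0 : 'I_n -> R) (f : 'I_n -> R -> R) :
  (forall j, \sum_i xi i * A i j = 0) -> linear_flow A a b f0 f ->
  forall u, a < u < b -> \sum_i xi i * f i u = \sum_i xi i * f0 i.
Proof.
move=> xiA [df f0E] u uab.
(* Stated for any left null vector [z]: the bounds for [xi] and for [- xi] together give
   equality. *)
have le_mean (z : 'I_n -> R) : (forall j, \sum_i z i * A i j = 0) ->
    \sum_i z i * f i u <= \sum_i z i * f0 i.
  move=> zA; apply: (@le_at_right_limit R (fun v => \sum_i z i * f i v)
    (fun=> 0) a b) => //; last first.
    apply: cvg_big => [|i _]; first exact: add_continuous.
    exact: cvgMl_tmp.
  move=> v vab.
  have -> : (fun v => \sum_i z i * f i v) = \sum_i z i *: f i.
    by rewrite fct_sumE.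
  have := is_derive_sum (fun i => is_deriveZ (z i) (df v vab i)).
  suff -> : \sum_i z i *: (\sum_j A i j * f j v) = 0 by [].
  under eq_bigr => i _ do rewrite scaler_sumr.
  rewrite exchange_big/= big1// => j _.
  under eq_bigr => i _ do rewrite scalerAl.
  by rewrite -mulr_suml zA mul0r.
apply/eqP; rewrite eq_le le_mean//= -lerN2 -!sumrN.
under eq_bigr do rewrite -mulNr.
under [leRHS]eq_bigr do rewrite -mulNr.
apply: (le_mean (fun i => - xi i)) => j.
by under eq_bigr do rewrite mulNr; rewrite sumrN xiA oppr0.
Qed.

(* With [V' <= - lam V], the function [(1 + lam (u - a)) V] is nonincreasing;
   this gives a decay rate in [1 / u], which suffices here. *)
Lemma linear_flow_energy (R : realType) (n : nat) (A : 'M[R]_n)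
    (xi : 'I_n -> R) (lam a b : R) (f0 : 'I_n -> R) (f : 'I_n -> R -> R) :
  (forall i, \sum_j A i j = 0) -> (forall j, \sum_i xi i * A i j = 0) ->
  (forall i, 0 <= xi i) -> 0 <= lam ->
  (forall y : 'I_n -> R,
     lam * \sum_i xi i * (y i - \sum_j xi j * y j) ^+ 2 <= dirichlet xi A y) ->
  linear_flow A a b f0 f ->
  let m := \sum_i xi i * f0 i in
  forall u, a < u < b ->
    (1 + lam * (u - a)) * \sum_i xi i * (f i u - m) ^+ 2 <=
    \sum_i xi i * (f0 i - m) ^+ 2.
Proof.
move=> A1 xiA xi0 lam0 poinc flow m u uab.
have [df f0E] := flow.
pose V v := \sum_i xi i * (f i v - m) ^+ 2.
pose D v := dirichlet xi A (fun i => f i v).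
have VE : V = \sum_i xi i *: (f i - cst m) ^+ 2 by rewrite fct_sumE.
have dV v : a < v < b -> is_derive v 1 V (- D v).
  move=> vab; rewrite VE.
  have := is_derive_sum (fun i => is_deriveZ (xi i) (is_deriveX 2
    (is_deriveB (df v vab i) (is_derive_cst m v 1)))).
  suff -> : - D v = \sum_i xi i *: ((2%:R * (f i - cst m) v ^+ 1) *:
      (\sum_j A i j * f j v - 0)) by [].
  rewrite -(dirichlet_energy (fun i => f i v) m A1 xiA) mulr_sumr.
  apply: eq_bigr => i _; rewrite subr0 expr1.
  transitivity (xi i * ((2 * (f i v - m)) * \sum_j A i j * f j v)) => //.
  ring.
apply: (@le_at_right_limit R (fun v => (1 + lam * (v - a)) * V v)
  (fun v => (1 + lam * (v - a)) * - D v + V v * lam) a b) => //.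
- move=> v vab.
  have dl : is_derive v 1 (fun v => 1 + lam * (v - a)) lam.
    have -> : (fun v => 1 + lam * (v - a)) = cst 1 + lam *: (id - cst a) by [].
    have := is_deriveD (is_derive_cst (1 : R) v 1) (is_deriveZ lam
      (is_deriveB (is_derive_id v (1 : R)) (is_derive_cst a v 1))).
    by rewrite add0r subr0 [lam *: 1]mulr1.
  exact: is_deriveM dl (dV v vab).
(* The mean at time [v] is still [m], so [lam V <= D] applies, and the derivative is at most
   [- lam (v - a) D <= 0]. *)
- move=> v vab.
  have := poinc (fun i => f i v).
  rewrite (linear_flow_mean xiA flow vab) -/m -/(D v) -/(V v) => VD.
  have lv0 : 0 <= lam * (v - a).
    by case/andP: vab => av _; rewrite mulr_ge0// subr_ge0 ltW.
  have D0 : 0 <= D v.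
    apply: le_trans VD; apply: mulr_ge0 => //; apply: sumr_ge0 => i _.
    by rewrite mulr_ge0 ?sqr_ge0.
  have := mulr_ge0 lv0 D0; move: VD.
  rewrite mulrN mulrDl mul1r [V v * _]mulrC; lra.
- rewrite -[X in _ --> X]mul1r; apply: cvgM.
    rewrite -[X in _ --> X]addr0; apply: cvgD; first exact: cvg_cst.
    rewrite -(mulr0 lam); apply: cvgMl_tmp; apply: cvg_at_right_filter.
    rewrite -(subrr a); apply: cvgB; [exact: cvg_id | exact: cvg_cst].
  apply: cvg_big => [|i _]; first exact: add_continuous.
  apply: cvgMl_tmp; rewrite !expr2.
  by apply: cvgM; apply: cvgB => //; exact: cvg_cst.
Qed.

(** Since [xi_i (f_i - m)^2 <= V] and [V <= D^2] initially, the decay of [V] passes to every node.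
    [K] and [T] are uniform in the interval and in the initial data, so that one [T] serves all
    gaps. *)
Lemma linear_flow_contraction (R : realType) (n : nat) (A : 'M[R]_n.+1)
    (xi : 'I_n.+1 -> R) :
  classA2 A -> (forall j, \sum_i xi i * A i j = 0) -> \sum_i xi i = 1 ->
  exists2 K : R, 0 <= K & forall eps : R, 0 < eps ->
  exists2 T : R, 0 < T & forall a b f0 f (D : R),
    linear_flow A a b f0 f ->
    (forall i, `|f0 i - \sum_j xi j * f0 j| <= D) ->
    forall u i, a < u < b ->
      `|f i u - \sum_j xi j * f0 j| <= K * D /\
      (a + T <= u -> `|f i u - \sum_j xi j * f0 j| <= eps * D).
Proof.
move=> A2 xiA xi1; have xi0 := left_eigenvector_gt0 A2 xiA xi1.
have [lam lam0 poinc] := dirichlet_poincare A2 xi0 xi1.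
pose C := \sum_i (xi i)^-1.
have xiC i : (xi i)^-1 <= C.
  rewrite /C (bigD1 i)//= lerDl sumr_ge0// => j _.
  by rewrite invr_ge0 ltW.
have C0 : 0 < C by apply: lt_le_trans (xiC ord0); rewrite invr_gt0.
(* Since [C <= (C + 1)^2], this choice avoids a square root. *)
exists (C + 1) => [|eps eps0]; first by rewrite addr_ge0// ltW.
(* Here [lam T = C / eps^2], which turns [lam (u - a) (f_i - m)^2 <= C D^2] into the bound
   [eps D]. *)
exists (C / (lam * eps ^+ 2)) => [|a b f0 f D flow f0D u i uab].
  by rewrite divr_gt0// mulr_gt0// exprn_gt0.
set m := \sum_j xi j * f0 j.
have D0 : 0 <= D := le_trans (normr_ge0 _) (f0D ord0).
have lau : 0 <= lam * (u - a).
  by case/andP: uab => au _; rewrite mulr_ge0 ?subr_ge0 ?ltW.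
have bound : (1 + lam * (u - a)) * (f i u - m) ^+ 2 <= C * D ^+ 2.
  have fi : xi i * (f i u - m) ^+ 2 <= \sum_j xi j * (f j u - m) ^+ 2.
    rewrite (bigD1 i)//= lerDl sumr_ge0// => j _.
    by rewrite mulr_ge0 ?sqr_ge0// ltW.
  have V0 : \sum_j xi j * (f0 j - m) ^+ 2 <= D ^+ 2.
    rewrite -[leRHS]mul1r -xi1 mulr_suml; apply: ler_sum => j _.
    by rewrite ler_pM2l// -real_normK ?num_real// ler_sqr ?nnegrE.
  have E := linear_flow_energy (classA2_rowsum A2) xiA
    (fun i => ltW (xi0 i)) (ltW lam0) poinc flow uab.
  have : xi i * ((1 + lam * (u - a)) * (f i u - m) ^+ 2) <= D ^+ 2.
    rewrite mulrCA; apply: le_trans V0; apply: le_trans E.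
    by rewrite ler_wpM2l// addr_ge0.
  rewrite mulrC -ler_pdivlMr// => /le_trans; apply.
  by rewrite mulrC ler_wpM2r ?sqr_ge0.
have sq0 := sqr_ge0 (f i u - m).
have norm_le c : 0 <= c -> (f i u - m) ^+ 2 <= c ^+ 2 * D ^+ 2 ->
    `|f i u - m| <= c * D.
  move=> c0; rewrite -exprMn -real_normK ?num_real// ler_sqr ?nnegrE//.
  exact: mulr_ge0.
split=> [|aTu]; apply: norm_le; rewrite ?(ltW eps0) ?addr_ge0 ?(ltW C0)//.
  apply: (@le_trans _ _ (C * D ^+ 2)).
    apply: le_trans bound; rewrite mulrDl mul1r lerDl; exact: mulr_ge0.
  by rewrite ler_wpM2r ?sqr_ge0//; nra.
have : C / eps ^+ 2 <= lam * (u - a).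
  have -> : C / eps ^+ 2 = lam * (C / (lam * eps ^+ 2)).
    by field; rewrite !gt_eqF.
  by rewrite ler_pM2l//; lra.
rewrite ler_pdivrMr ?exprn_gt0// => Cle.
rewrite -(ler_pM2l C0); apply: (@le_trans _ _
  (lam * (u - a) * eps ^+ 2 * (f i u - m) ^+ 2)); first exact: ler_wpM2r.
have -> : lam * (u - a) * eps ^+ 2 * (f i u - m) ^+ 2 =
  eps ^+ 2 * (lam * (u - a) * (f i u - m) ^+ 2) by ring.
rewrite [leRHS]mulrCA ler_pM2l ?exprn_gt0//.
by apply: le_trans bound; rewrite mulrDl mul1r lerDr.
Qed.

(** * Effect of a single impulse *)

(* The deviation [D] before the impulse enters only through [eps * D]; weighting
   it by a small [kappa] therefore makes the whole quantity contract. *)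
Lemma impulse_contraction (R : realType) (n : nat) (xi y z : 'I_n.+1 -> R)
    (s beta eta1 eta2 m D : R) :
  (forall i, 0 < xi i) -> \sum_i xi i = 1 -> xi ord0 * eta2 < 1 ->
  0 < eta1 -> eta1 <= beta <= eta2 ->
  let p := xi ord0 * eta1 in
  let kappa := p / (2 * (eta2 + 2)) in
  \sum_i xi i * y i = m -> (forall i, `|y i - m| <= kappa / 4 * D) ->
  z ord0 = y ord0 + beta * (s - y ord0) ->
  (forall i, i != ord0 -> z i = y i) ->
  let m' := \sum_i xi i * z i in
  let D' := (eta2 + 2) * (`|m - s| + kappa / 4 * D) in
  (forall i, `|z i - m'| <= D') /\
  `|m' - s| + kappa * D' <= (1 - p / 2) * (`|m - s| + kappa * D).
Proof.
move=> xi0 xi1 q1 eta10 /andP[beta1 beta2] p kappa ym yD z0 zi m' D'.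
have eta20 : 0 < eta2 by lra.
have p0 : 0 < p by rewrite mulr_gt0.
have p1 : p < 1 by apply: le_lt_trans q1; rewrite ler_pM2l//; lra.
(* [kappa] is chosen so that the deviation created by the impulse costs only half of the gain
   [p]. *)
have kB : kappa * (eta2 + 2) = p / 2 by rewrite /kappa; field; lra.
have kappa0 : 0 < kappa by rewrite divr_gt0//; lra.
have m'E : m' = m + xi ord0 * (beta * (s - y ord0)).
  rewrite /m' -ym !(bigD1 (P := xpredT) ord0)//= z0 mulrDr addrAC.
  by congr (_ + _ + _); apply: eq_bigr => i i0; rewrite zi.
set E := kappa / 4 * D in yD D' *.
have E0 : 0 <= E := le_trans (normr_ge0 _) (yD ord0).
have D0 : kappa * D = 4 * E by rewrite /E; field.
have M0 : 0 <= `|m - s| by [].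
have xb0 : 0 <= xi ord0 * beta by rewrite mulr_ge0 ?(ltW (xi0 _))//; lra.
(* The upper bound on [eta2] keeps the factor [1 - xi ord0 * beta] of [m - s] nonnegative. *)
have xb1 : xi ord0 * beta <= 1.
  by apply: ltW; apply: le_lt_trans q1; rewrite ler_pM2l.
have pxb : p <= xi ord0 * beta by rewrite ler_pM2l.
have gap : `|s - y ord0| <= `|m - s| + E.
  have -> : s - y ord0 = - (m - s) - (y ord0 - m) by ring.
  by apply: le_trans (ler_normB _ _) _; rewrite normrN lerD.
have jump : `|beta * (s - y ord0)| <= eta2 * (`|m - s| + E).
  rewrite normrM ger0_norm; last lra.
  apply: ler_pM => //; lra.
have shift : `|m' - m| <= `|m - s| + E.
  have -> : m' - m = xi ord0 * beta * (s - y ord0) by rewrite m'E; ring.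
  rewrite normrM ger0_norm// -[leRHS]mul1r; exact: ler_pM.
split=> [i|].
  have zy : `|z i - y i| <= eta2 * (`|m - s| + E).
    have [->|/zi->] := eqVneq i ord0; first by rewrite z0 addrAC subrr add0r.
    by rewrite subrr normr0 mulr_ge0//; lra.
  (* The three terms are at most [eta2 (|m - s| + E)], [E] and [|m - s| + E], whence the factor
     [eta2 + 2]. *)
  have -> : z i - m' = (z i - y i) + (y i - m) - (m' - m) by ring.
  apply: le_trans (ler_normB _ _) _; apply: le_trans (lerD (ler_normD _ _) shift) _.
  by rewrite /D'; have := yD i; lra.
have M' : `|m' - s| <= (1 - p) * `|m - s| + E.
  have -> : m' - s = (1 - xi ord0 * beta) * (m - s) -
    xi ord0 * beta * (y ord0 - m) by rewrite m'E; ring.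
  apply: le_trans (ler_normB _ _) _.
  rewrite (normrM (1 - _)) (normrM (xi ord0 * beta)).
  rewrite ger0_norm ?subr_ge0// (ger0_norm xb0).
  apply: lerD; first by rewrite ler_wpM2r//; lra.
  by rewrite -[leRHS]mul1r ler_pM.
rewrite /D' mulrA kB mulrDr [in leRHS]D0.
(* What remains is [(1 + p / 2) E <= (1 - p / 2) 4 E], which holds as [p <= 1]; the 4 comes from the
   accuracy [kappa / 4]. *)
have : p * E <= E by rewrite -[leRHS]mul1r ler_wpM2r// ltW.
move: M'; lra.
Qed.

(** * Iteration over the impulses and convergence to [s] *)

Theorem theorem1 (R : realType) (n : nat) (L : 'M[R]_n.+1) (xi : 'rV[R]_n.+1)
    (s eta1 eta2 : R) (b : nat -> R) (x0 : 'cV[R]_n.+1)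
    (L_A2 : classA2 (- L))
    (xi_eigen : xi *m L = 0 *: xi) (xi_sum : \sum_i xi 0 i = 1)
    (eta1_gt0 : 0 < eta1) (eta12 : eta1 <= eta2) (eta2_lt : eta2 < 1 / xi 0 ord0)
    (b_bnd : forall k, eta1 <= b k <= eta2)
    (x0_neq : \sum_i xi 0 i * x0 i 0 != s) :
  exists T : R, 0 < T /\
    forall t : nat -> R,
      t 0%N = 0 -> (forall k, t k < t k.+1) ->
      (forall k, T <= t k.+1 - t k) ->
      forall x : R -> 'cV[R]_n.+1,
        pinned_solution L b t s x0 x ->
        forall i : 'I_n.+1, x u i 0 @[u --> +oo] --> s.
Proof.
have xiA j : \sum_i xi 0 i * (- L) i j = 0.
  under eq_bigr do rewrite mxE mulrN.
  by move/rowP/(_ j): xi_eigen; rewrite !mxE mul0r sumrN => ->; rewrite oppr0.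
have xi0 := left_eigenvector_gt0 L_A2 xiA xi_sum.
have q1 : xi 0 ord0 * eta2 < 1.
  by rewrite mulrC; move: eta2_lt; rewrite ltr_pdivlMr.
have p0 : 0 < xi 0 ord0 * eta1 by rewrite mulr_gt0.
have p1 : xi 0 ord0 * eta1 < 1 by apply: le_lt_trans q1; rewrite ler_pM2l.
pose kappa := xi 0 ord0 * eta1 / (2 * (eta2 + 2)).
have kappa0 : 0 < kappa by rewrite divr_gt0//; lra.
pose rho := 1 - xi 0 ord0 * eta1 / 2.
have [K K0 /(_ (kappa / 4))[|T0 T00 rate]] :=
  linear_flow_contraction L_A2 xiA xi_sum; first by rewrite divr_gt0.
(* The extra 1 leaves times after [t k + T0] strictly before the next impulse, and later yields
   [k <= t k]. *)
exists (T0 + 1); split=> [|t t0 tlt tT x [x_0 x_ode x_right x_imp] i].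
  by rewrite addr_gt0.
pose mean k := \sum_j xi 0 j * x (t k) j 0.
have t_lt : {homo t : k l / (k < l)%N >-> k < l} := homo_ltn lt_trans tlt.
have t_le : {homo t : k l / (k <= l)%N >-> k <= l}.
  by move=> k l; rewrite leq_eqVlt => /predU1P[->//|/t_lt/ltW].
have flow k : linear_flow (- L) (t k) (t k.+1) (fun j => x (t k) j 0)
    (fun j v => x v j 0).
  split=> [u /andP[ku uk] j|j]; last exact: x_right.
  have -> : \sum_l (- L) j l * x u l 0 = - \sum_l L j l * x u l 0.
    by rewrite -sumrN; apply: eq_bigr => l _; rewrite mxE mulNr.
  apply: x_ode => [|l]; first by apply: le_lt_trans ku; rewrite -t0 t_le.
  have [lk|kl] := leqP l k; first by rewrite gt_eqF// (le_lt_trans (t_le _ _ lk)).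
  by rewrite lt_eqF// (lt_le_trans uk)// t_le.
(* One cycle: the flow from [t k] up to the left limit at [t k.+1], then the impulse. *)
have step k D : (forall j, `|x (t k) j 0 - mean k| <= D) ->
  exists D', (forall j, `|x (t k.+1) j 0 - mean k.+1| <= D') /\
    `|mean k.+1 - s| + kappa * D' <= rho * (`|mean k - s| + kappa * D).
  move=> kD; have [xm [xmE xm0 xmi]] := x_imp k.+1 isT.
  have ym : \sum_j xi 0 j * xm j 0 = mean k.
    have sumE : \sum_j xi 0 j * x u j 0 @[u --> (t k.+1)^'-] -->
        \sum_j xi 0 j * xm j 0.
      apply: cvg_big => [|j _]; [exact: add_continuous | exact: cvgMl_tmp].
    have near_mean : \forall u \near (t k.+1)^'-,
        \sum_j xi 0 j * x u j 0 = mean k.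
      near=> u; apply: (linear_flow_mean xiA (flow k)); apply/andP; split.
        by near: u; exact: nbhs_left_gt.
      by near: u; exact: nbhs_left_lt.
    apply/eqP; rewrite eq_le; apply/andP; split.
      by apply: cvgr_to_le sumE _; apply: filterS near_mean => u ->.
    by apply: cvgr_to_ge sumE _; apply: filterS near_mean => u ->.
  have yD j : `|xm j 0 - mean k| <= kappa / 4 * D.
    have nE : `|x u j 0 - mean k| @[u --> (t k.+1)^'-] --> `|xm j 0 - mean k|.
      by apply: cvg_norm; apply: cvgB => //; exact: cvg_cst.
    apply: cvgr_to_le nE _; near=> u.
    have Tu : t k + T0 < u.
      by near: u; apply: nbhs_left_gt; have := tT k; lra.
    have [] := rate _ _ _ _ D (flow k) kD u j.
      apply/andP; split; first by apply: lt_trans Tu; rewrite ltrDl.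
      by near: u; exact: nbhs_left_lt.
    by move=> _; apply; exact: ltW.
  by have := impulse_contraction xi0 xi_sum q1 eta1_gt0 (b_bnd k.+1) ym yD
    xm0 xmi; eexists; eassumption.
pose D0 := \sum_j `|x (t 0%N) j 0 - mean 0%N|.
pose W0 := `|mean 0%N - s| + kappa * D0.
(* [D] is some upper bound of the deviations, passed on by [step], rather than their maximum. *)
have inv k : exists D, (forall j, `|x (t k) j 0 - mean k| <= D) /\
    `|mean k - s| + kappa * D <= rho ^+ k * W0.
  elim: k => [|k [D [kD kW]]].
    exists D0; split=> [j|]; last by rewrite mul1r.
    by rewrite /D0 (bigD1 j)//= lerDl sumr_ge0.
  have [D' [kD' kW']] := step k D kD; exists D'; split=> //.
  apply: le_trans kW' _; rewrite exprS -mulrA ler_wpM2l// /rho; lra.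
(* [C] satisfies [1 <= C] and [K + 1 <= C * kappa], so [C] times the contracting quantity dominates
   the distance to [s] throughout the gap. *)
pose C := 1 + (K + 1) / kappa.
have C0 : 0 < C by rewrite addr_gt0// divr_gt0// ltr_wpDl.
have bound k u : t k <= u < t k.+1 -> `|s - x u i 0| <= C * (rho ^+ k * W0).
  move=> /andP[ku uk]; have [D [kD kW]] := inv k.
  have Dk0 : 0 <= D := le_trans (normr_ge0 _) (kD ord0).
  (* The flow bound [K * D] covers the open gap and [D] covers [u = t k]; the factor [K + 1] serves
     both. *)
  have uD : `|x u i 0 - mean k| <= (K + 1) * D.
    have [<-|ku'] := eqVneq (t k) u.
      apply: le_trans (kD i) _; have := mulr_ge0 K0 Dk0; lra.
    have [|+ _] := rate _ _ _ _ D (flow k) kD u i.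
      by rewrite lt_neqAle ku' ku.
    by move=> /le_trans; apply; lra.
  apply: (@le_trans _ _ (C * (`|mean k - s| + kappa * D))).
    rewrite distrC.
    have -> : x u i 0 - s = (x u i 0 - mean k) + (mean k - s) by ring.
    apply: le_trans (ler_normD _ _) _; apply: le_trans (lerD uD (lexx _)) _.
    rewrite [leLHS]addrC.
    have -> : C * (`|mean k - s| + kappa * D) = `|mean k - s| + (K + 1) * D +
      (kappa * D + (K + 1) / kappa * `|mean k - s|).
      by rewrite /C; field; rewrite gt_eqF.
    have Kk0 : 0 <= (K + 1) / kappa by rewrite divr_ge0 ?addr_ge0 ?(ltW kappa0).
    rewrite lerDl; apply: addr_ge0; apply: mulr_ge0 => //; exact: ltW.
  by rewrite ler_pM2l.
have W00 : 0 <= W0.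
  by rewrite addr_ge0// mulr_ge0 ?(ltW kappa0)// sumr_ge0.
have rho01 : 0 <= rho < 1 by rewrite /rho; apply/andP; split; lra.
have t_ge k : k%:R <= t k.
  elim: k => [|k IH]; first by rewrite t0.
  by rewrite -natr1; have := tT k; lra.
have small : C * (rho ^+ k * W0) @[k --> \oo] --> 0.
  rewrite -(mulr0 C); apply: cvgMl_tmp; rewrite -[X in _ --> X](mul0r W0).
  apply: cvgMr_tmp; apply: cvg_expr.
  by case/andP: rho01 => r0 r1; rewrite ger0_norm.
apply/cvgrPdist_le => e e0.
have /cvgrPdist_le/(_ e e0) := small.
move=> [N _ Nsmall]; near=> u.
have Nu : t N < u by near: u; apply: nbhs_pinfty_gt; rewrite num_real.
have ex_k : exists k, u < t k.
  exists (Num.trunc u).+1; apply: lt_le_trans (t_ge _).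
  by rewrite truncnS_gt.
(* The least index with [u < t k] is not 0, as [t N < u]; its predecessor locates [u] in a gap of
   index at least [N]. *)
have := ex_minnP ex_k; case => [[|k]] uk kmin.
  by move: (lt_trans Nu uk); rewrite ltNge t_le.
have ku : t k <= u by rewrite leNgt; apply/negP => /kmin; rewrite ltnn.
have Nk : (N <= k)%N.
  by rewrite leqNgt; apply/negP => /t_le /(lt_le_trans uk)/(lt_trans Nu);
    rewrite ltxx.
apply: le_trans (bound k u _) _; first by rewrite ku uk.
have := Nsmall k Nk; rewrite /= sub0r normrN; apply: le_trans; exact: ler_norm.
Unshelve. all: by end_near. Qed.
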